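(* For every $\mathbf{MD}^+$-formula $\phi$: $\models\phi$ if and only if $\vdash^0_{\mathbf{MD}^+}\phi$.
   Context: **Language of $\mathbf{MD}^+$ (extended modal dependence logic).** Fix a set $\mathrm{Prop}$ of propositional variables. Classical formulas: $\alpha::=p\mid\bot\mid\neg\alpha\mid\alpha\wedge\alpha\mid\alpha\otimes\alpha\mid\Box\alpha\mid\Diamond\alpha$. Formulas: $\phi::=\alpha\mid\;=\!(\alpha_1,\dots,\alpha_n,\beta)\mid\phi\wedge\phi\mid\phi\otimes\phi\mid\Box\phi\mid\Diamond\phi$, where $n\ge0$ and $\alpha,\alpha_i,\beta$ are classical. Negation applies to classical formulas only. **Team semantics.** A Kripke model is $\mathfrak{M}=(W,R,V)$ with $W\neq\emptyset$, $R\subseteq W\times W$, $V:\mathrm{Prop}\to\wp(W)$. A team is any $X\subseteq W$. $R(X)=\{w\in W\mid\exists v\in X,\ vRw\}$, $R(w)=R(\{w\})$; $XRY$ means $Y\subseteq R(X)$ and $Y\cap R(w)\ne\emptyset$ for every $w\in X$. Satisfaction: - $\mathfrak{M},X\models p$ iff $X\subseteq V(p)$; $\mathfrak{M},X\models\bot$ iff $X=\emptyset$; $\mathfrak{M},X\models\neg\alpha$ iff $\mathfrak{M},\{w\}\not\models\alpha$ for all $w\in X$. - $\mathfrak{M},X\models\phi\wedge\psi$ iff $\mathfrak{M},X\models\phi$ and $\mathfrak{M},X\models\psi$. - $\mathfrak{M},X\models\phi\otimes\psi$ iff $X=Y\cup Z$ for some $Y,Z\subseteq X$ with $\mathfrak{M},Y\models\phi$,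 $\mathfrak{M},Z\models\psi$. - $\mathfrak{M},X\models\Box\phi$ iff $\mathfrak{M},R(X)\models\phi$; $\mathfrak{M},X\models\Diamond\phi$ iff there is $Y\subseteq W$ with $XRY$ and $\mathfrak{M},Y\models\phi$. - $\mathfrak{M},X\models\;=\!(\alpha_1,\dots,\alpha_n,\beta)$ iff for all $w,u\in X$: if ($\mathfrak{M},\{w\}\models\alpha_i\Leftrightarrow\mathfrak{M},\{u\}\models\alpha_i$) for all $1\le i\le n$, then ($\mathfrak{M},\{w\}\models\beta\Leftrightarrow\mathfrak{M},\{u\}\models\beta$). $\models\phi$ (validity) means $\mathfrak{M},X\models\phi$ for all models $\mathfrak{M}$ and all teams $X$ of $\mathfrak{M}$. **The weaker natural deduction system ($\vdash^0$).** ($\phi,\psi,\chi,\theta$ range over formulas, $\alpha,\alpha_i,\beta$ over classical formulas; $[\cdot]$ marks discharged assumptions; subderivations may use further undischarged assumptions unless stated otherwise.) - Conjunction: from $\phi$ and $\psi$ infer $\phi\wedge\psi$; from $\phi\wedge\psi$ infer $\phi$; from $\phi\wedge\psi$ infer $\psi$. - From $\neg\neg\alpha$ infer $\alpha$; from $\bot$ infer $\phi$. - $\neg$I: from a derivation of $\bot$ from $[\alpha]$ infer $\neg\alpha$. $\neg$E: from $\alpha$ and $\neg\alpha$ infer $\bot$. - $\Box$Mon: from $\Box\phi_1,\dots,\Box\phi_k$ ($k\ge0$) and a derivation of $\psi$ from $[\phi_1],\dots,[\phi_k]$ having no other undischarged assumptions, infer $\Box\psi$. - $\Diamond$Mon: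 from $\Diamond\phi$ and a derivation of $\psi$ from $[\phi]$ having no other undischarged assumptions, infer $\Diamond\psi$. - From $\neg\Box\alpha$ infer $\Diamond\neg\alpha$; from $\Diamond\neg\alpha$ infer $\neg\Box\alpha$. - Tensor: from $\phi$ infer $\phi\otimes\psi$; from $\phi\otimes\psi$ infer $\psi\otimes\phi$; from $\phi\otimes(\psi\otimes\chi)$ infer $(\phi\otimes\psi)\otimes\chi$; from $\phi\otimes\psi$, a derivation of $\alpha$ from $[\phi]$ and a derivation of $\alpha$ from $[\psi]$ ($\alpha$ classical), infer $\alpha$; from $\phi\otimes\psi$ and a derivation of $\chi$ from $[\psi]$, infer $\phi\otimes\chi$. - DepI$_0$: from $\alpha$ infer $=\!(\alpha)$; from $\neg\alpha$ infer $=\!(\alpha)$. - DepE$_0$: from $=\!(\alpha)$, a derivation of $\theta$ from $[\alpha]$ and a derivation of $\theta$ from $[\neg\alpha]$, infer $\theta$. - DepI$_k$: from a derivation of $=\!(\beta)$ from $[=\!(\alpha_1)],\dots,[=\!(\alpha_k)]$ infer $=\!(\alpha_1,\dots,\alpha_k,\beta)$. $\vdash^0_{\mathbf{MD}^+}\phi$ means there is a derivation of $\phi$ in this system with no undischarged assumptions. *)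

(* Defs.v *)
From mathcomp Require Import all_boot boolp classical_sets.
From Stdlib Require List.

Set Implicit Arguments.
Unset Strict Implicit.
Unset Printing Implicit Defensive.

Local Open Scope classical_set_scope.

Inductive cform (P : Type) : Type :=
| CVar of P
| CBot
| CNeg of cform P
| CAnd of cform P & cform P
| CTensor of cform P & cform P
| CBox of cform P
| CDia of cform P.

Arguments CBot {P}.

(* The clause "phi ::= alpha" of the grammar is spread over the constructors:
   a classical conjunction is built by FAnd, etc., so that every formula of the
   language has exactly one representation.  [emb] below is the inclusion of
   the classical formulas.  [FDep [:: a1; ..; an] b] is =(a1, .., an, b). *)
Inductive form (P : Type) : Type :=
| FVar of P
| FBot
| FNeg of cform P
| FDep of seq (cform P) & cform P
| FAnd of form P & form P
| FTensor of form P & form P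
| FBox of form P
| FDia of form P.

Arguments FBot {P}.

Fixpoint emb (P : Type) (a : cform P) : form P :=
  match a with
  | CVar p => FVar p
  | CBot => FBot
  | CNeg a => FNeg a
  | CAnd a b => FAnd (emb a) (emb b)
  | CTensor a b => FTensor (emb a) (emb b)
  | CBox a => FBox (emb a)
  | CDia a => FDia (emb a)
  end.

Record kripke (P : Type) : Type := Kripke {
  world : Type;
  world_inhabited : inhabited world;
  acc : world -> world -> Prop;
  val : P -> set world
}.

Definition team (P : Type) (M : kripke P) : Type := set (world M).

Section TeamSemantics.
Variables (P : Type) (M : kripke P).
Implicit Types (X Y Z : team M) (w u v : world M).

(* R(X) *)
Definition post X : team M := [set w | exists2 v, X v & acc v w].

(* X R Y *)
Definition lift_acc X Y : Prop :=
  Y `<=` post X /\ forall w, X w -> Y `&` post [set w] !=set0.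

(* The semantic clauses, as operations on team properties; they are shared by
   the satisfaction relations of the two syntactic layers. *)
Definition t_var (p : P) (X : team M) : Prop := X `<=` val p.

Definition t_bot (X : team M) : Prop := X = set0.

Definition t_neg (A : team M -> Prop) (X : team M) : Prop :=
  forall w, X w -> ~ A [set w].

Definition t_and (A B : team M -> Prop) (X : team M) : Prop := A X /\ B X.

Definition t_tensor (A B : team M -> Prop) (X : team M) : Prop :=
  exists Y Z, [/\ X = Y `|` Z, A Y & B Z].

Definition t_box (A : team M -> Prop) (X : team M) : Prop := A (post X).

Definition t_dia (A : team M -> Prop) (X : team M) : Prop :=
  exists2 Y, lift_acc X Y & A Y.

Fixpoint csat (a : cform P) : team M -> Prop :=
  match a with
  | CVar p => t_var p
  | CBot => t_bot
  | CNeg a => t_neg (csat a)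
  | CAnd a b => t_and (csat a) (csat b)
  | CTensor a b => t_tensor (csat a) (csat b)
  | CBox a => t_box (csat a)
  | CDia a => t_dia (csat a)
  end.

Definition t_dep (s : seq (cform P)) (b : cform P) (X : team M) : Prop :=
  forall w u, X w -> X u ->
    (forall a, List.In a s -> (csat a [set w] <-> csat a [set u])) ->
    (csat b [set w] <-> csat b [set u]).

Fixpoint sat (f : form P) : team M -> Prop :=
  match f with
  | FVar p => t_var p
  | FBot => t_bot
  | FNeg a => t_neg (csat a)
  | FDep s b => t_dep s b
  | FAnd f g => t_and (sat f) (sat g)
  | FTensor f g => t_tensor (sat f) (sat g)
  | FBox f => t_box (sat f)
  | FDia f => t_dia (sat f)
  end.

Lemma sat_emb (a : cform P) : sat (emb a) = csat a.
Proof. by elim: a => //= [a -> b ->|a -> b ->|a ->|a ->]. Qed.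

End TeamSemantics.

Definition valid (P : Type) (f : form P) : Prop :=
  forall (M : kripke P) (X : team M), sat f X.

(* [nd0 G f]: there is a derivation of f all of whose undischarged assumptions
   occur in G. *)
Inductive nd0 (P : Type) : seq (form P) -> form P -> Prop :=
| nd_ass G f : List.In f G -> nd0 G f
| nd_andI G f g : nd0 G f -> nd0 G g -> nd0 G (FAnd f g)
| nd_andEl G f g : nd0 G (FAnd f g) -> nd0 G f
| nd_andEr G f g : nd0 G (FAnd f g) -> nd0 G g
| nd_dnegE G a : nd0 G (FNeg (CNeg a)) -> nd0 G (emb a)
| nd_botE G f : nd0 G FBot -> nd0 G f
| nd_negI G a : nd0 (emb a :: G) FBot -> nd0 G (FNeg a)
| nd_negE G a : nd0 G (emb a) -> nd0 G (FNeg a) -> nd0 G FBot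
| nd_boxMon G D g :
    (forall f, List.In f D -> nd0 G (FBox f)) -> nd0 D g -> nd0 G (FBox g)
| nd_diaMon G f g : nd0 G (FDia f) -> nd0 [:: f] g -> nd0 G (FDia g)
| nd_negbox G a : nd0 G (FNeg (CBox a)) -> nd0 G (FDia (FNeg a))
| nd_dianeg G a : nd0 G (FDia (FNeg a)) -> nd0 G (FNeg (CBox a))
| nd_tensorI G f g : nd0 G f -> nd0 G (FTensor f g)
| nd_tensorC G f g : nd0 G (FTensor f g) -> nd0 G (FTensor g f)
| nd_tensorA G f g h :
    nd0 G (FTensor f (FTensor g h)) -> nd0 G (FTensor (FTensor f g) h)
| nd_tensorE G f g a :
    nd0 G (FTensor f g) -> nd0 (f :: G) (emb a) -> nd0 (g :: G) (emb a) ->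
    nd0 G (emb a)
| nd_tensorSub G f g h :
    nd0 G (FTensor f g) -> nd0 (g :: G) h -> nd0 G (FTensor f h)
| nd_depI0 G a : nd0 G (emb a) -> nd0 G (FDep [::] a)
| nd_depI0neg G a : nd0 G (FNeg a) -> nd0 G (FDep [::] a)
| nd_depE0 G a f :
    nd0 G (FDep [::] a) -> nd0 (emb a :: G) f -> nd0 (FNeg a :: G) f ->
    nd0 G f
| nd_depI G s b :
    nd0 ([seq FDep [::] a | a <- s] ++ G) (FDep [::] b) -> nd0 G (FDep s b).

(* Main.v *)
Require Import Defs.
From mathcomp Require Import all_boot.
From mathcomp Require Import boolp classical_sets.
From Stdlib Require List.

(** Completeness rests on the canonical model of the classical fragment, whose
    worlds are the maximal consistent sets of classical formulas.  Whenever a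
    team satisfies [f], it satisfies some classical [a] with [a |- f] (a
    dependence atom is resolved by reading off, on the given team, the function
    it asserts to exist).  Applied to the team of all worlds of the canonical
    model, this turns a valid [f] into a classical [a] that is true at every
    maximal consistent set, hence provable, so that [f] is provable as well. *)

Set Implicit Arguments.
Unset Strict Implicit.
Unset Printing Implicit Defensive.

Local Open Scope classical_set_scope.

(** * Team semantics and soundness of the calculus *)

Section Semantics.
Context {P : Type}.
Implicit Types (M : kripke P) (a b : cform P) (f g : form P).

(** Ordinary pointwise Kripke semantics, with [CTensor] read as disjunction. *)
Fixpoint force M (w : world M) a : Prop :=
  match a with
  | CVar p => Defs.val p w
  | CBot => False
  | CNeg a => ~ force w a
  | CAnd a b => force w a /\ force w b
  | CTensor a b => force w a \/ force w b
  | CBox a => forall v, acc w v -> force v a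
  | CDia a => exists2 v, acc w v & force v a
  end.

(** Flatness: a team splits along the disjunct true at each world, and all successors that force [a]
    can be gathered into one team. *)
Lemma csat_force M a (X : team M) : csat a X <-> forall w, X w -> force w a.
Proof.
elim: a X => [p||a IH|a IHa b IHb|a IHa b IHb|a IH|a IH] X /=.
- by [].
- rewrite /t_bot; split=> [-> //|X0].
  by apply/seteqP; split=> // w /X0.
- split=> Xa w Xw aw; first by case: (Xa w Xw); apply/IH => _ ->.
  by move/IH: aw => /(_ w erefl); exact: Xa.
- split=> [[/IHa Xa /IHb Xb] w Xw|Xab].
    by split; [exact: Xa|exact: Xb].
  by split; [apply/IHa|apply/IHb] => w /Xab[].
- split=> [[Y [Z [-> /IHa Ya /IHb Zb]]] w|Xab].
    by case=> [/Ya|/Zb]; [left|right].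
  exists [set w | X w /\ force w a], [set w | X w /\ force w b]; split.
  + apply/seteqP; split=> [w Xw|w]; last by case=> -[].
    by case: (Xab w Xw); [left|right].
  + by apply/IHa => w [].
  + by apply/IHb => w [].
- rewrite /t_box IH; split=> Xa w; first by move=> Xw v wv; apply: Xa; exists w.
  by case=> v Xv; apply: Xa.
- split=> [[Y [_ YX] /IH Ya] w /YX[v [Yv [_ -> wv]]]|Xa].
    by exists v => //; exact: Ya.
  exists [set v | post X v /\ force v a]; last by apply/IH => v [].
  split=> [v []//|w Xw]; have [v wv va] := Xa w Xw.
  by exists v; split; [split=> //; exists w|exists w].
Qed.

Lemma csat1 M a (w : world M) : csat a [set w] <-> force w a.
Proof. by rewrite csat_force; split=> [|aw _ ->//]; apply. Qed.

Lemma sat_emb_force M a (X : team M) :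
  sat (emb a) X <-> forall w, X w -> force w a.
Proof. by rewrite sat_emb csat_force. Qed.

Lemma sat_dep M s b (X : team M) : sat (FDep s b) X <->
  forall w u, X w -> X u ->
    (forall a, List.In a s -> (force w a <-> force u a)) ->
    (force w b <-> force u b).
Proof.
split=> Xd w u Xw Xu wu; have /= := Xd w u Xw Xu; rewrite !csat1; apply.
  by move=> a /wu; rewrite !csat1.
by move=> a /wu; rewrite !csat1.
Qed.

Lemma sat_dep0 M b (X : team M) : sat (FDep [::] b) X <->
  (forall w, X w -> force w b) \/ (forall w, X w -> ~ force w b).
Proof.
rewrite sat_dep; split=> [Xb|[Xb|Xb] w u /Xb + /Xb]; [|by []|by []].
have [[w [Xw wb]]|Xnb] := pselect (exists w, X w /\ force w b).
  by left=> u Xu; apply/(Xb w u).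
by right=> w Xw wb; apply: Xnb; exists w.
Qed.

(** Downward closure; it lets side assumptions pass to the subteams on which subderivations are
    evaluated. *)
Lemma sat_sub M f (X Y : team M) : Y `<=` X -> sat f X -> sat f Y.
Proof.
elim: f X Y => [p||a|s b|f IHf g IHg|f IHf g IHg|f IHf|f IHf] X Y /= YX.
- exact: subset_trans.
- by rewrite /t_bot => X0; apply/seteqP; split=> // w /YX; rewrite X0.
- by move=> Xa w /YX /Xa.
- by move=> Xd w u /YX Xw /YX Xu; apply: Xd.
- by case=> Xf Xg; split; [apply: IHf Xf|apply: IHg Xg].
- case=> [U [V [XUV Uf Vg]]]; exists (Y `&` U), (Y `&` V); split.
  + by rewrite -setIUr -XUV setIidl.
  + by apply: IHf Uf => w [].
  + by apply: IHg Vg => w [].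
- by apply: IHf => w [v /YX Xv vw]; exists v.
(* Trimming [Z] to the successors of [Y] keeps every point of [Z] seen from a world of [Y]. *)
- case=> Z [ZX XZ] Zf; exists (Z `&` post Y); last by apply: IHf Zf => w [].
  split=> [w []//|w Yw]; have [v [Zv [w' /= w'w wv]]] := XZ w (YX w Yw).
  rewrite w'w in wv; exists v; split; last by exists w.
  by split=> //; exists w.
Qed.

(** Empty team property; it makes ex falso and [nd_tensorI] sound. *)
Lemma sat_set0 M f : sat f (set0 : team M).
Proof.
have post0 : post set0 = set0 :> team M.
  by apply/seteqP; split=> // w [].
elim: f => [p||a|s b|f IHf g IHg|f IHf g IHg|f IHf|f IHf] //=.
- by exists set0, set0; split; rewrite ?setU0.
- by rewrite /t_box post0.
- by exists set0 => //; split.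
Qed.

Lemma nd0_sound G f : nd0 G f ->
  forall M (X : team M), (forall g, List.In g G -> sat g X) -> sat f X.
Proof.
elim=> {G f}.
- by move=> G f Gf M X; apply.
- by move=> G f g _ IHf _ IHg M X XG; split; [apply: IHf|apply: IHg].
- by move=> G f g _ IH M X /IH[].
- by move=> G f g _ IH M X /IH[].
- move=> G a _ IH M X /IH; rewrite -[FNeg _]/(emb (CNeg (CNeg a))).
  by rewrite !sat_emb_force => Xa w /Xa /contrapT.
- by move=> G f _ IH M X /IH /= ->; exact: sat_set0.
- move=> G a _ IH M X XG; apply/(sat_emb_force (CNeg a)) => w Xw wa.
  (* Negation is evaluated pointwise, so the subderivation is used on a singleton team, where [FBot]
     fails. *)
  suff: sat FBot [set w] by move=> /= /seteqP[/(_ w erefl)].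
  apply: IH => g [<-|/XG]; first by apply/sat_emb_force => _ ->.
  by apply: sat_sub => _ ->.
- move=> G a _ IHa _ IHna M X XG.
  move: (IHa M X XG) (IHna M X XG); rewrite -[FNeg _]/(emb (CNeg a)).
  rewrite -[FBot]/(emb CBot) !sat_emb_force => Xa Xna w Xw.
  exact: Xna (Xa w Xw).
- move=> G D g _ IHD _ IHg M X XG; apply: IHg => f Df.
  exact: IHD.
- by move=> G f g _ IHf _ IHg M X /IHf[Y XY Yf]; exists Y => //; apply: IHg => _ [<-|[]].
- move=> G a _ IH M X /IH; rewrite -[FNeg _]/(emb (CNeg (CBox a))).
  rewrite -[FDia _]/(emb (CDia (CNeg a))) !sat_emb_force => Xa w /Xa /=.
  by move=> /existsNP[v /not_implyP[wv va]]; exists v.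
- move=> G a _ IH M X /IH; rewrite -[FNeg (CBox _)]/(emb (CNeg (CBox a))).
  rewrite -[FDia _]/(emb (CDia (CNeg a))) !sat_emb_force => Xa w /Xa /=.
  by case=> v wv va /(_ v wv).
- move=> G f g _ IH M X /IH Xf; exists X, set0.
  by split; [rewrite setU0|exact: Xf|exact: sat_set0].
- by move=> G f g _ IH M X /IH[Y [Z [-> Yf Zg]]]; exists Z, Y; rewrite setUC.
- move=> G f g h _ IH M X /IH[Y [_ [-> Yf [U [V [-> Ug Vh]]]]]].
  by exists (Y `|` U), V; split; rewrite ?setUA //; exists Y, U.
- move=> G f g a _ IH _ IHf _ IHg M X XG.
  have [Y [Z [XYZ Yf Zg]]] := IH M X XG.
  have YX : Y `<=` X by rewrite XYZ; left.
  have ZX : Z `<=` X by rewrite XYZ; right.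
  have Ya : sat (emb a) Y by apply: IHf => h [<-//|/XG]; apply: sat_sub.
  have Za : sat (emb a) Z by apply: IHg => h [<-//|/XG]; apply: sat_sub.
  apply/sat_emb_force => w; rewrite XYZ.
  by case; [move/sat_emb_force: Ya|move/sat_emb_force: Za]; apply.
- move=> G f g h _ IH _ IHh M X XG.
  have [Y [Z [XYZ Yf Zg]]] := IH M X XG.
  exists Y, Z; split=> //; apply: IHh => k [<-//|/XG]; apply: sat_sub.
  by rewrite XYZ; right.
- by move=> G a _ IH M X /IH /sat_emb_force Xa; apply/sat_dep0; left.
- by move=> G a _ IH M X /IH /(sat_emb_force (CNeg a)) Xa; apply/sat_dep0; right.
- move=> G a f _ IHd _ IHa _ IHna M X XG.
  have /sat_dep0[Xa|Xna] := IHd M X XG.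
    by apply: IHa => g [<-|/XG//]; apply/sat_emb_force.
  by apply: IHna => g [<-|/XG//]; apply/(sat_emb_force (CNeg a)).
- move=> G s b _ IH M X XG; apply/sat_dep => w u Xw Xu wu.
  (* On the team of just [w] and [u], the discharged atoms hold because the two worlds agree on all
     of [s]. *)
  suff /sat_dep : sat (FDep [::] b) [set w; u].
    by apply=> //; [left|right].
  apply: IH => g /List.in_app_iff[/List.in_map_iff[a [<- /wu aE]]|/XG].
    by apply/sat_dep => _ _ [->|->] [->|->] //; rewrite aE.
  by apply: sat_sub => _ [->|->].
Qed.

End Semantics.

(** * Substitution in derivations and classical realizers *)

Ltac hyp := apply: nd_ass => /=; by repeat (try (by left); right).

Section Derivations.
Context {P : Type}.
Implicit Types (G D : seq (form P)) (a b c : cform P) (f g h : form P).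

Lemma incl_cons2 G D f : List.incl G D -> List.incl (f :: G) (f :: D).
Proof. by move=> GD g [<-|/GD]; [left|right]. Qed.

Lemma nd_weak G D f : List.incl G D -> nd0 G f -> nd0 D f.
Proof.
move=> GD nf; elim: nf D GD => {G f}.
- by move=> G f Gf D GD; apply: nd_ass; exact: GD.
- by move=> G f g _ IHf _ IHg D GD; apply: nd_andI; [exact: IHf|exact: IHg].
- by move=> G f g _ IH D GD; apply: nd_andEl; exact: IH.
- by move=> G f g _ IH D GD; apply: nd_andEr; exact: IH.
- by move=> G a _ IH D GD; apply: nd_dnegE; exact: IH.
- by move=> G f _ IH D GD; apply: nd_botE; exact: IH.
- by move=> G a _ IH D GD; apply/nd_negI/IH/incl_cons2.
- by move=> G a _ IHa _ IHna D GD; apply: nd_negE; [exact: IHa|exact: IHna].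
- by move=> G E g _ IHE ng _ D GD; apply: (nd_boxMon _ ng) => f Ef; exact: IHE.
- by move=> G f g _ IHf ng _ D GD; apply: nd_diaMon ng; exact: IHf.
- by move=> G a _ IH D GD; apply: nd_negbox; exact: IH.
- by move=> G a _ IH D GD; apply: nd_dianeg; exact: IH.
- by move=> G f g _ IH D GD; apply: nd_tensorI; exact: IH.
- by move=> G f g _ IH D GD; apply: nd_tensorC; exact: IH.
- by move=> G f g h _ IH D GD; apply: nd_tensorA; exact: IH.
- move=> G f g a _ IH _ IHf _ IHg D GD.
  by apply: nd_tensorE (IH _ GD) _ _; [apply/IHf/incl_cons2|apply/IHg/incl_cons2].
- move=> G f g h _ IH _ IHg D GD.
  by apply: nd_tensorSub (IH _ GD) _; apply/IHg/incl_cons2.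
- by move=> G a _ IH D GD; apply: nd_depI0; exact: IH.
- by move=> G a _ IH D GD; apply: nd_depI0neg; exact: IH.
- move=> G a f _ IH _ IHa _ IHna D GD.
  by apply: nd_depE0 (IH _ GD) _ _; [apply/IHa/incl_cons2|apply/IHna/incl_cons2].
- move=> G s b _ IH D GD; apply/nd_depI/IH => f /List.in_app_iff[sf|/GD Df].
    by apply/List.in_app_iff; left.
  by apply/List.in_app_iff; right.
Qed.

(** Under a discharged assumption both contexts grow, which [ext] handles by weakening; the
    subderivations of the modal monotonicity rules have their own context and stay unchanged. *)
Lemma nd_subst G D f : (forall g, List.In g G -> nd0 D g) -> nd0 G f -> nd0 D f.
Proof.
have ext h (G1 D1 : seq (form P)) : (forall g, List.In g G1 -> nd0 D1 g) ->
    forall g, List.In g (h :: G1) -> nd0 (h :: D1) g.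
  move=> GD g [<-|/GD]; first by apply: nd_ass; left.
  by apply: nd_weak => k; right.
move=> GD nf; elim: nf D GD => {G f}.
- by move=> G f Gf D; apply.
- by move=> G f g _ IHf _ IHg D GD; apply: nd_andI; [exact: IHf|exact: IHg].
- by move=> G f g _ IH D GD; apply: nd_andEl; exact: IH.
- by move=> G f g _ IH D GD; apply: nd_andEr; exact: IH.
- by move=> G a _ IH D GD; apply: nd_dnegE; exact: IH.
- by move=> G f _ IH D GD; apply: nd_botE; exact: IH.
- by move=> G a _ IH D GD; apply/nd_negI/IH/ext.
- by move=> G a _ IHa _ IHna D GD; apply: nd_negE; [exact: IHa|exact: IHna].
- by move=> G E g _ IHE ng _ D GD; apply: (nd_boxMon _ ng) => f Ef; exact: IHE.
- by move=> G f g _ IHf ng _ D GD; apply: nd_diaMon ng; exact: IHf.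
- by move=> G a _ IH D GD; apply: nd_negbox; exact: IH.
- by move=> G a _ IH D GD; apply: nd_dianeg; exact: IH.
- by move=> G f g _ IH D GD; apply: nd_tensorI; exact: IH.
- by move=> G f g _ IH D GD; apply: nd_tensorC; exact: IH.
- by move=> G f g h _ IH D GD; apply: nd_tensorA; exact: IH.
- move=> G f g a _ IH _ IHf _ IHg D GD.
  by apply: nd_tensorE (IH _ GD) _ _; [apply/IHf/ext|apply/IHg/ext].
- by move=> G f g h _ IH _ IHg D GD; apply: nd_tensorSub (IH _ GD) _; apply/IHg/ext.
- by move=> G a _ IH D GD; apply: nd_depI0; exact: IH.
- by move=> G a _ IH D GD; apply: nd_depI0neg; exact: IH.
- move=> G a f _ IH _ IHa _ IHna D GD.
  by apply: nd_depE0 (IH _ GD) _ _; [apply/IHa/ext|apply/IHna/ext].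
- move=> G s b _ IH D GD; apply/nd_depI/IH => f /List.in_app_iff[sf|/GD].
    by apply: nd_ass; apply/List.in_app_iff; left.
  by apply: nd_weak => g Dg; apply/List.in_app_iff; right.
Qed.

Lemma nd_cut1 G f g : nd0 G f -> nd0 [:: f] g -> nd0 G g.
Proof. by move=> Gf; apply: nd_subst => _ [<-|[]]. Qed.

(** Each connective is realized by its classical counterpart, since the calculus is monotone in its
    arguments. For a dependence atom, the team is split along the members of [s] and the constant
    value of [b] on each piece is recorded. *)
Lemma sat_realization (M : kripke P) f (X : team M) :
  sat f X -> exists2 a, csat a X & nd0 [:: emb a] f.
Proof.
elim: f X => [p||a|s b|f IHf g IHg|f IHf g IHg|f IHf|f IHf] X.
- by exists (CVar p) => //; hyp.
- by exists CBot => //; hyp.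
- by exists (CNeg a) => //; hyp.
(* [nd_depI] leaves a goal with one assumption per member of [s], suited to induction on [s]. *)
- move=> Xd; suff [a Xa na] : exists2 a, csat a X &
      nd0 ([seq FDep [::] c | c <- s] ++ [:: emb a]) (FDep [::] b).
    by exists a => //; exact: nd_depI.
  elim: s X Xd => [|c s IHs] X /sat_dep Xd.
    have /sat_dep0[Xb|Xnb] : sat (FDep [::] b) X by apply/sat_dep.
      exists b; first exact/csat_force.
      by apply: nd_depI0; hyp.
    exists (CNeg b); first exact/csat_force.
    by apply: nd_depI0neg; hyp.
  (* Among worlds that agree on [c], the value of [b] depends on [s] alone, so the induction
     hypothesis applies to both halves. *)
  have [|a1 Xa1 na1] := IHs [set w | X w /\ force w c].
    apply/sat_dep => w u [Xw wc] [Xu uc] wu; apply: Xd => // a.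
    by case=> [<-|/wu].
  have [|a0 Xa0 na0] := IHs [set w | X w /\ ~ force w c].
    apply/sat_dep => w u [Xw wc] [Xu uc] wu; apply: Xd => // a.
    by case=> [<-|/wu].
  exists (CTensor (CAnd c a1) (CAnd (CNeg c) a0)).
    apply/csat_force => w Xw /=; have [wc|wc] := pselect (force w c).
      by left; split=> //; move/csat_force: Xa1; apply.
    by right; split=> //; move/csat_force: Xa0; apply.
  set S := _ ++ _.
  have St : List.In (FTensor (FAnd (emb c) (emb a1)) (FAnd (FNeg c) (emb a0))) S.
    by right; apply/List.in_app_iff; right; left.
  have Ss h : List.In h [seq FDep [::] c | c <- s] -> List.In h S.
    by move=> sh; right; apply/List.in_app_iff; left.
  (* The atom on [c] decides [c] for the whole team. One disjunct of the realizer is then refuted,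
     and [nd_tensorE] yields [a1] or [a0], which are classical as that rule demands. *)
  apply: (@nd_depE0 _ _ c); first by hyp.
  + apply: nd_subst na1 => h /List.in_app_iff[/Ss Sh|[<-|[]]].
      by apply: nd_ass; right.
    apply: nd_tensorE; first by apply: nd_ass; right; exact: St.
      by apply: (@nd_andEr _ _ (emb c)); hyp.
    apply: nd_botE; apply: (@nd_negE _ _ c); first by hyp.
    by apply: (@nd_andEl _ _ _ (emb a0)); hyp.
  + apply: nd_subst na0 => h /List.in_app_iff[/Ss Sh|[<-|[]]].
      by apply: nd_ass; right.
    apply: nd_tensorE; first by apply: nd_ass; right; exact: St.
      apply: nd_botE; apply: (@nd_negE _ _ c); last by hyp.
      by apply: (@nd_andEl _ _ _ (emb a1)); hyp.
    by apply: (@nd_andEr _ _ (FNeg c)); hyp.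
- case=> /IHf[a Xa na] /IHg[b Xb nb]; exists (CAnd a b) => //=.
  apply: nd_andI.
    by apply: nd_cut1 na; apply: nd_andEl; hyp.
  by apply: nd_cut1 nb; apply: nd_andEr; hyp.
- case=> [Y [Z [XYZ /IHf[a Ya na] /IHg[b Zb nb]]]].
  exists (CTensor a b); first by exists Y, Z.
  (* [nd_tensorSub] acts on the right component only, so the tensor is commuted to reach the other
     one. *)
  apply: (@nd_tensorSub _ _ _ (emb b)); last by apply: nd_cut1 nb; hyp.
  apply/nd_tensorC/(@nd_tensorSub _ _ _ (emb a)); last by apply: nd_cut1 na; hyp.
  by apply: nd_tensorC; hyp.
- move=> /IHf[a Xa na]; exists (CBox a) => //=.
  by apply: nd_boxMon na => _ [<-|[]]; hyp.
- case=> Y XY /IHf[a Ya na]; exists (CDia a); first by exists Y.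
  by apply: nd_diaMon na; hyp.
Qed.

End Derivations.

(** * Consistent sets and Lindenbaum's lemma *)

Section CanonicalModel.
Context {P : Type}.
Implicit Types (G : seq (cform P)) (A B : set (cform P)) (a b : cform P).

(** Contexts of [nd0] are finite lists, so entailment from an arbitrary set goes through a finite
    support. *)
Definition entails A a :=
  exists2 G, (forall b, List.In b G -> A b) & nd0 [seq emb b | b <- G] (emb a).

Lemma entails_nd G A a : (forall b, List.In b G -> entails A b) ->
  nd0 [seq emb b | b <- G] (emb a) -> entails A a.
Proof.
move=> GA na; suff [H HA HG] : exists2 H, (forall b, List.In b H -> A b) &
    forall b, List.In b G -> nd0 [seq emb c | c <- H] (emb b).
  by exists H => //; apply: nd_subst na => _ /List.in_map_iff[b [<- /HG]].
elim: G GA {na} => [|b G IH] GA; first by exists [::].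
have [c Gc|H HA HG] := IH; first by apply: GA; right.
have [|K KA Kb] := GA b; first by left.
exists (K ++ H) => [c /List.in_app_iff[/KA|/HA]//|c [<-|/HG]].
  apply: nd_weak Kb => _ /List.in_map_iff[d [<- Kd]].
  by apply/List.in_map_iff; exists d; split=> //; apply/List.in_app_iff; left.
apply: nd_weak => _ /List.in_map_iff[d [<- Hd]].
by apply/List.in_map_iff; exists d; split=> //; apply/List.in_app_iff; right.
Qed.

Lemma entails_mem A a : A a -> entails A a.
Proof. by move=> Aa; exists [:: a] => [_ [<-|[]]//|]; hyp. Qed.

(** The members of the support taken from [A] are collected in [H]; any other member is [a], which
    [nd_negI] discharges. *)
Lemma entails_neg A a : entails (A `|` [set a]) CBot -> entails A (CNeg a).
Proof.
case=> G GA nG; suff [H HA GH] : exists2 H, (forall b, List.In b H -> A b) &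
    List.incl G (a :: H).
  exists H => //; apply: nd_negI; apply: nd_weak nG.
  move=> _ /List.in_map_iff[b [<- /GH[<-|Hb]]]; first by left.
  by right; apply/List.in_map_iff; exists b.
elim: G GA {nG} => [|b G IH] GA; first by exists [::].
have [c Gc|H HA GH] := IH; first by apply: GA; right.
have [Ab|->] := GA b (or_introl erefl).
  exists (b :: H) => [c [<-//|/HA]//|c [<-|/GH[<-|Hc]]].
  - by right; left.
  - by left.
  - by right; right.
by exists H => // c [<-|/GH//]; left.
Qed.

Definition consistent A := ~ entails A CBot.

Lemma consistentU A a :
  consistent A -> consistent (A `|` [set a]) \/ consistent (A `|` [set CNeg a]).
Proof.
move=> cA; apply: contrapT => /not_orP[/contrapT/entails_neg Ana].
move=> /contrapT/entails_neg Anna; apply: cA.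
apply: (@entails_nd [:: CNeg a; CNeg (CNeg a)]); first by move=> _ [<-|[<-|[]]].
by apply: (@nd_negE _ _ (CNeg a)); hyp.
Qed.

Definition max_consistent A := consistent A /\ forall a, A a \/ A (CNeg a).

(** Soundness on a one-world model, whose nonempty team refutes [FBot]. *)
Lemma consistent0 : consistent set0.
Proof.
case=> -[|b G] GA; last by case: (GA b); left.
pose M := @Kripke P unit (inhabits tt) (fun _ _ => False) (fun _ => set0).
move=> /nd0_sound/(_ M setT) nb.
have /= /seteqP[/(_ tt)] : sat FBot (setT : team M) by apply: nb.
by move=> /(_ I).
Qed.

(** Zorn's lemma is applied to the sets [B] whose union with [A] is consistent, not to supersets of
    [A]; this way the empty chain, whose union is empty, is covered too. *)
Lemma lindenbaum A : consistent A -> exists2 B, A `<=` B & max_consistent B.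
Proof.
move=> cA; have [] := @Zorn_bigcup _ (fun B => consistent (A `|` B)).
  move=> F Fc Ftot [G GF nG].
  (* A derivation of [CBot] uses finitely many formulas; as [F] is a chain, one member of [F]
     contains all those outside [A]. *)
  have : (forall b, List.In b G -> A b) \/
      exists2 B, F B & forall b, List.In b G -> (A `|` B) b.
    elim: G GF {nG} => [|b G IH] GF; first by left.
    have [c Gc|GA|[B FB GB]] := IH; first by apply: GF; right.
    - case: (GF b (or_introl erefl)) => [Ab|[B FB Bb]].
        by left=> c [<-|/GA].
      by right; exists B => // c [<-|/GA]; [right|left].
    - case: (GF b (or_introl erefl)) => [Ab|[C FC Cb]]; right.
        by exists B => // c [<-|/GB//]; left.
      case: (Ftot B C FB FC) => BC.
        exists C => // c [<-|/GB[]]; [by right|by left|].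
        by move=> /BC; right.
      by exists B => // c [<-|/GB//]; right; exact: BC.
  by case=> [GA|[B FB GB]]; [apply: cA|apply: (Fc B FB)]; exists G.
move=> B [cAB Bmax]; exists (A `|` B); first by left.
have ext b : consistent (A `|` B `|` [set b]) -> (A `|` B) b.
  move=> cb; apply: contrapT => nb; apply: (Bmax (B `|` [set b])); last by rewrite setUA.
  by split=> [c|/(_ b)]; [left|move=> Bb; apply: nb; right; apply: Bb; right].
split=> // a; by case: (consistentU a cAB) => /ext; [left|right].
Qed.

(** * Closure properties of maximal consistent sets *)

Section MaxConsistent.
Variables (A : set (cform P)).
Hypothesis mA : max_consistent A.

(** Otherwise [CNeg a] would lie in [A] and contradict the derived [a]. *)
Lemma mc_nd G a : (forall b, List.In b G -> A b) ->
  nd0 [seq emb b | b <- G] (emb a) -> A a.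
Proof.
move=> GA na; have [cA /(_ a)[//|Ana]] := mA; case: cA.
apply: (@entails_nd [:: a; CNeg a]); last by apply: (@nd_negE _ _ a); hyp.
by move=> _ [<-|[<-|[]]]; [exists G|exact: entails_mem].
Qed.

Lemma mc_bot : ~ A CBot.
Proof. by move=> /entails_mem; case: mA. Qed.

Lemma mc_neg a : A (CNeg a) <-> ~ A a.
Proof.
split=> [Ana Aa|nAa]; last by case: mA => _ /(_ a)[].
apply: mc_bot; apply: (@mc_nd [:: a; CNeg a]); first by move=> _ [<-|[<-|[]]].
by apply: (@nd_negE _ _ a); hyp.
Qed.

Lemma mc_and a b : A (CAnd a b) <-> A a /\ A b.
Proof.
split=> [Aab|[Aa Ab]].
  by split; apply: (@mc_nd [:: CAnd a b]); try (by move=> _ [<-|[]]);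
    [apply: (@nd_andEl _ _ _ (emb b))|apply: (@nd_andEr _ _ (emb a))]; hyp.
apply: (@mc_nd [:: a; b]); first by move=> _ [<-|[<-|[]]].
by apply: nd_andI; hyp.
Qed.

Lemma mc_tensor a b : A (CTensor a b) <-> A a \/ A b.
Proof.
split=> [Aab|Aab].
  apply: contrapT => /not_orP[/mc_neg Ana /mc_neg Anb].
  apply: mc_bot; apply: (@mc_nd [:: CTensor a b; CNeg a; CNeg b]).
    by move=> _ [<-|[<-|[<-|[]]]].
  apply: (@nd_tensorE _ _ (emb a) (emb b) CBot); first by hyp.
    by apply: (@nd_negE _ _ a); hyp.
  by apply: (@nd_negE _ _ b); hyp.
case: Aab => [Aa|Ab].
  apply: (@mc_nd [:: a]); first by move=> _ [<-|[]].
  by apply: nd_tensorI; hyp.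
apply: (@mc_nd [:: b]); first by move=> _ [<-|[]].
by apply/nd_tensorC/nd_tensorI; hyp.
Qed.

(** If the required seed set were inconsistent, finitely many [b] with [CBox b] in [A] would derive
    [a] by double negation, and [nd_boxMon] would put [CBox a] into [A]. *)
Lemma mc_box a : ~ A (CBox a) -> exists B,
  [/\ max_consistent B, forall b, A (CBox b) -> B b & ~ B a].
Proof.
move=> nAa.
have [|B AB mB] := @lindenbaum ((fun b => A (CBox b)) `|` [set CNeg a]).
  move=> /entails_neg[G GA na]; apply: nAa.
  apply: (@mc_nd [seq CBox b | b <- G]).
    by move=> _ /List.in_map_iff[b [<- /GA]].
  apply: (@nd_boxMon _ _ [seq emb b | b <- G]); last exact: nd_dnegE.
  move=> _ /List.in_map_iff[b [<- Gb]]; apply: nd_ass.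
  apply/List.in_map_iff; exists (CBox b); split=> //.
  by apply/List.in_map_iff; exists b.
exists B; split=> // [b Ab|Ba]; first by apply: AB; left.
have Bna : B (CNeg a) by apply: AB; right.
case: mB => cB _; apply: cB; exists [:: a; CNeg a]; first by move=> _ [<-|[<-|[]]].
by apply: (@nd_negE _ _ a); hyp.
Qed.

(** The rules link negated boxes to diamonds of negations only, so [nd_diaMon] exchanges [a] with
    its double negation under the diamond. *)
Lemma mc_dia a : A (CDia a) <-> ~ A (CBox (CNeg a)).
Proof.
rewrite -mc_neg; split=> Aa.
  apply: (@mc_nd [:: CDia a]); first by move=> _ [<-|[]].
  apply/nd_dianeg/(@nd_diaMon _ _ (emb a)); first by hyp.
  by apply: nd_negI; apply: (@nd_negE _ _ a); hyp.
apply: (@mc_nd [:: CNeg (CBox (CNeg a))]); first by move=> _ [<-|[]].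
apply: (@nd_diaMon _ _ (FNeg (CNeg a))); first by apply: nd_negbox; hyp.
by apply: nd_dnegE; hyp.
Qed.

End MaxConsistent.

(** * The canonical model and completeness of the classical fragment *)

Definition canon_world := {A : set (cform P) | max_consistent A}.

Lemma canon_world_inhabited : inhabited canon_world.
Proof.
by have [A _ mA] := lindenbaum consistent0; exact: (inhabits (exist _ A mA)).
Qed.

Definition canon : kripke P :=
  Kripke canon_world_inhabited
    (fun A B : canon_world => forall a, sval A (CBox a) -> sval B a)
    (fun p => [set A : canon_world | sval A (CVar p)]).

(** [mc_box] supplies the successor refuting a box outside [A] and, applied to [CNeg a], the one
    witnessing a diamond. *)
Lemma truth_lemma a (A : world canon) : force A a <-> sval A a.
Proof.
elim: a A => [p||a IH|a IHa b IHb|a IHa b IHb|a IH|a IH] A /=; have mA := svalP A.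
- by [].
- by split=> // /(mc_bot mA).
- by rewrite (mc_neg mA) IH.
- by rewrite (mc_and mA) IHa IHb.
- by rewrite (mc_tensor mA) IHa IHb.
- split=> [Aa|Aa B AB]; last exact/IH/AB.
  apply: contrapT => /(mc_box mA)[B [mB AB]]; apply.
  exact/(IH (exist _ B mB))/Aa.
- rewrite (mc_dia mA); split=> [[B AB /IH Ba] /AB|].
    by move=> /(mc_neg (svalP B)).
  move=> /(mc_box mA)[B [mB AB /(mc_neg mB)/contrapT Ba]].
  by exists (exist _ B mB) => //; apply/IH.
Qed.

(** Were [CNeg a] consistent, it would lie in some maximal consistent set, a world where [a] fails
    by the truth lemma. *)
Lemma canon_complete a : csat a (setT : team canon) -> nd0 [::] (emb a).
Proof.
move=> /csat_force Ca; apply: nd_dnegE.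
(* A support inside the empty set is the empty list, so no assumption remains. *)
suff [[|b G] GA na] : entails set0 (CNeg (CNeg a)).
- exact: na.
- by case: (GA b); left.
apply: entails_neg; apply: contrapT => /lindenbaum[A Aa mA].
move: (Aa _ (or_intror erefl)) => /(mc_neg mA); apply.
exact/(truth_lemma a (exist _ A mA))/Ca.
Qed.

End CanonicalModel.

Theorem theorem2p23 (P : Type) (f : form P) : valid f <-> nd0 [::] f.
Proof.
split=> [vf|nf M X]; last by apply: (nd0_sound nf) => g [].
have [a /canon_complete na] := sat_realization (vf canon setT).
exact: nd_cut1.
Qed.
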